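(* Let $n\ge1$ and let $(K,\star)$ be a pointed Kan complex which is trivial in the dimensions lower than $n$, i.e. $K_{n-1}=\{\star\}$. If $n\ge2$, then the Hurewicz homomorphism $\varphi\colon\pi_n(K,\star)\to H_n(K,\star)$, $\varphi([x]_\pi)=[x]_H$, is an isomorphism. If $n=1$, the homomorphism induced by $\varphi$ on the abelianization of $\pi_1(K,\star)$ is an isomorphism onto $H_1(K,\star)$.
   Context: For a pointed Kan complex $(K,\star)$ (a simplicial set satisfying the horn filling condition, with base point $\star\in K_0$; its degenerate images in each dimension are also denoted $\star$, and they form a simplicial subset also denoted $\star$), write $\partial x=(d_0x,\dots,d_nx)$ for $x\in K_n$; a tuple is ''filled'' if it equals $\partial x$ for some $x$. Two $n$-simplices with $\partial x=\partial y$ are homotopic, $x\sim y$, if $(s_{n-1}d_0x,\dots,s_{n-1}d_{n-1}x,x,y)$ is filled. $\pi_n(K,\star)=\{x\in K_n:\partial x=(\star,\dots,\star)\}/\!\sim$, with group structure for $n\ge1$ given by $[x][y]=[xy]$ whenever $(\star,\dots,\star,y,xy,x)$ is filled. For a simplicial pair $(K,L)$, $H_n(K,L)$ is the homology with coefficients in $\mathbb{Z}$ of the chain complex $C_n(K,L)=\mathbb{Z}[K_n]/\mathbb{Z}[L_n]$ with differential $\mathbf{d}(x)=\sum_{i=0}^n(-1)^i(d_ix)$; $[x]_H$ denotes the class of a simplex $x$ which is a cycle. $H_n(K,\star)$ is the homology of $K$ relative to the subcomplex generated by $\star$. *)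

(* Defs.v *)
From HB Require Import structures.
From mathcomp Require Import all_boot all_order all_algebra.
From mathcomp Require Import generic_quotient ring_quotient.
From mathcomp Require Import boolp freeg zify.

Set Implicit Arguments.
Unset Strict Implicit.
Unset Printing Implicit Defensive.

Import GRing.Theory.
Local Open Scope ring_scope.
Local Open Scope quotient_scope.

(* Indices are ordinals; [inord] lets the identities be written with plain    *)
(* natural numbers, each of which is in range under the stated bounds.        *)
Record sset := SSet {
  simplex :> nat -> Type;
  face : forall n, 'I_n.+2 -> simplex n.+1 -> simplex n;
  degen : forall n, 'I_n.+1 -> simplex n -> simplex n.+1;
  face_face : forall n (i j : nat) (x : simplex n.+2), (i < j <= n.+2)%N ->
    face (inord i) (face (inord j) x) = face (inord j.-1) (face (inord i) x);
  degen_degen : forall n (i j : nat) (x : simplex n), (i <= j <= n)%N ->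
    degen (inord i) (degen (inord j) x) = degen (inord j.+1) (degen (inord i) x);
  face_degen_lt : forall n (i j : nat) (x : simplex n.+1), (i < j <= n.+1)%N ->
    face (inord i) (degen (inord j) x) = degen (inord j.-1) (face (inord i) x);
  face_degen_eq : forall n (i j : nat) (x : simplex n), (j <= i <= j.+1)%N -> (j <= n)%N ->
    face (inord i) (degen (inord j) x) = x;
  face_degen_gt : forall n (i j : nat) (x : simplex n.+1), (j.+1 < i <= n.+2)%N ->
    face (inord i) (degen (inord j) x) = degen (inord j) (face (inord i.-1) x)
}.

Arguments face {s n}.
Arguments degen {s n}.

Section Kan.
Variable K : sset.

Definition filled n (t : 'I_n.+2 -> K n) : Prop :=
  exists w : K n.+1, forall i, face i w = t i.

(* The entry [t k] is a dummy: it is never constrained nor required.          *)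
Definition horn n (k : 'I_n.+2) : ('I_n.+2 -> K n) -> Prop :=
  if n is m.+1 then fun t =>
    forall i j : nat, (i < j <= m.+2)%N -> i <> k -> j <> k ->
      face (inord i) (t (inord j)) = face (inord j.-1) (t (inord i))
  else fun=> True.

Definition kan : Prop :=
  forall n (k : 'I_n.+2) (t : 'I_n.+2 -> K n), horn k t ->
    exists w : K n.+1, forall i, i != k -> face i w = t i.

(* Here n = m.+1; the tuple is (s_{n-1} d_0 x, ..., s_{n-1} d_{n-1} x, x, y).   *)
Definition homotopic m (x y : K m.+1) : Prop :=
  (forall i, face i x = face i y) /\
  filled (fun i : 'I_m.+3 =>
    if (i <= m)%N then degen ord_max (face (inord i) x)
    else if i == m.+1 :> nat then x else y).

End Kan.

Record ptd_kan := PtdKan {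
  kan_sset :> sset;
  base0 : kan_sset 0%N;
  kanP : kan kan_sset
}.

Fixpoint base (K : ptd_kan) n : K n :=
  if n is m.+1 then degen ord0 (base K m) else base0 K.

Section Base.
Variable K : ptd_kan.

Lemma degen_base n (i : 'I_n.+1) : degen i (base K n) = base K n.+1.
Proof.
elim: n i => [|n IHn] i; first by rewrite (ord1 i).
rewrite /= -{1}[i]inord_val; case: i => -[|i] lti /=.
  by congr degen; apply/val_inj; rewrite /= inordK.
rewrite -[ord0]inord_val -degen_degen; last by [].
rewrite IHn /= -[ord0]inord_val /=; congr (degen _ (degen _ _)).
by apply/val_inj; rewrite /= !inordK.
Qed.

Lemma face_base n (i : 'I_n.+2) : face i (base K n.+1) = base K n.
Proof.
elim: n i => [|n IHn] i; rewrite -[i]inord_val.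
  by rewrite -(degen_base (inord 0)) face_degen_eq //=; apply: (ltn_ord i).
rewrite -(degen_base (inord 0)); case: i => -[|[|i]] lti.
- by rewrite face_degen_eq.
- by rewrite face_degen_eq.
by rewrite face_degen_gt //= IHn (degen_base (inord 0)).
Qed.

Definition sphere m :=
  {x : {classic K m.+1} | `[< forall i, face i (x : K m.+1) = base K m >]}.
HB.instance Definition _ m := Choice.on (sphere m).

Definition sval_sphere m (x : sphere m) : K m.+1 := val x.
Coercion sval_sphere : sphere >-> simplex.

Lemma face_sphere m (x : sphere m) i : face i x = base K m.
Proof. by move: i; apply/asboolP/(valP x). Qed.

Lemma sphere_base m : `[< forall i, face i (base K m.+1) = base K m >].
Proof. by apply/asboolP => i; apply: face_base. Qed.

Definition sbase m : sphere m := exist _ (base K m.+1) (sphere_base m).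

(* The (m.+3)-tuple (b, ..., b, p, q, r), with b the base point, is filled.   *)
Definition triple m (p q r : K m.+1) : Prop :=
  filled (fun i : 'I_m.+3 =>
    if (i < m)%N then base K m.+1
    else if i == m :> nat then p else if i == m.+1 :> nat then q else r).

Lemma filled_ext n (t u : 'I_n.+2 -> K n) : t =1 u -> filled t -> filled u.
Proof. by move=> tu [w wt]; exists w => i; rewrite wt. Qed.

Lemma face2 n (w : K n.+2) (i j : nat) : (i <= j <= n.+1)%N ->
  face (inord j) (face (inord i) w) = face (inord i) (face (inord j.+1) w).
Proof. by move=> /andP[ij jn]; rewrite (@face_face _ _ i j.+1) //= ltnS ij. Qed.

Lemma filled_matrix m (a : nat -> nat -> K m.+1) (k : 'I_m.+4) :
  let row j := fun l : 'I_m.+3 => if (l < j)%N then a l j else a j l.+1 in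
  (forall j : 'I_m.+4, j != k -> filled (row j)) -> filled (row k).
Proof.
move=> row rows.
have [t tE] : exists t : 'I_m.+4 -> K m.+2,
    forall j, j != k -> forall l, face l (t j) = row j l.
  suff /choice[t tE] : forall j, exists w : K m.+2,
      j != k -> forall l, face l w = row j l by exists t.
  move=> j; have [->|/rows[w wE]] := eqVneq j k; first by exists (base K m.+2).
  by exists w.
have tE' (j l : nat) : (j <= m.+3)%N -> j <> k -> (l <= m.+2)%N ->
    face (inord l) (t (inord j)) = if (l < j)%N then a l j else a j l.+1.
  by move=> jm /eqP jk lm; rewrite tE /row -?val_eqE /= !inordK.
have tk : horn k t.
  move=> i j ijm ik jk; rewrite !tE'; try lia.
  by rewrite ifT ?ifF; try lia; rewrite prednK //; lia.
have [w wE] := kanP tk; exists (face k w) => l; rewrite /row.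
have wE' (j : nat) : (j <= m.+3)%N -> j <> k -> face (inord j) w = t (inord j).
  by move=> jm /eqP jk; rewrite wE // -val_eqE /= inordK.
rewrite -[X in face X w]inord_val -[l in LHS]inord_val.
have lm := ltn_ord l; have km := ltn_ord k.
case: ltnP => lk.
  rewrite face_face ?wE' ?tE'; try lia.
  by rewrite ifF ?prednK //; lia.
by rewrite face2 ?wE' ?tE'; try lia; rewrite ifT //; lia.
Qed.

(* Rows of a matrix that is the base point away from its last four indices,   *)
(* labelled a, b, c, d.                                                       *)
Lemma four_triples m (ab ac ad bc bd cd : K m.+1) (k : 'I_4) :
  let P := fun j : nat => match j with
    | 0 => triple ab ac ad | 1 => triple ab bc bd
    | 2 => triple ac bc cd | _ => triple ad bd cd end in
  (forall j : 'I_4, j != k -> P j) -> P k.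
Proof.
move=> P Ps.
pose b := base K m.+1.
pose a (i j : nat) :=
  if (i < m)%N then b
  else if i == m then if j == m.+1 then ab else if j == m.+2 then ac else ad
  else if i == m.+1 then if j == m.+2 then bc else bd else cd.
pose row (j : nat) := fun l : 'I_m.+3 => if (l < j)%N then a l j else a j l.+1.
have rowP (j : 'I_4) : P j <-> filled (row (m + j)%N).
  case: j => -[|[|[|[|//]]]] lj; rewrite /P /= ?addn0 ?addn1 ?addn2 ?addn3;
    split; apply: filled_ext => l; rewrite /row /a -/b; have := ltn_ord l;
    repeat (case: ltnP => ? //=); repeat (case: eqP => ? //=); lia.
have mk (j : 'I_4) : (m + j < m.+4)%N by have := ltn_ord j; lia.
apply/rowP; apply: (@filled_matrix m a (Ordinal (mk k))) => j jk.
have [jm|mj] := ltnP j m.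
  by exists (base K m.+2) => l; rewrite face_base /a jm; case: ltnP => //= lj;
     rewrite (ltn_trans lj jm).
have jm4 : (j - m < 4)%N by have := ltn_ord j; lia.
have := Ps (Ordinal jm4); rewrite rowP /= subnKC //; apply.
by apply: contra jk => /eqP <-; rewrite -val_eqE /= subnKC.
Qed.

Lemma four_triplesA m (ab ac ad bc bd cd : K m.+1) :
  triple ab bc bd -> triple ac bc cd -> triple ad bd cd -> triple ab ac ad.
Proof.
move=> ? ? ?; apply: (@four_triples m ab ac ad bc bd cd (@Ordinal 4 0 isT)).
by case=> -[|[|[|[|//]]]] //= ?; rewrite -val_eqE.
Qed.

Lemma four_triplesB m (ab ac ad bc bd cd : K m.+1) :
  triple ab ac ad -> triple ac bc cd -> triple ad bd cd -> triple ab bc bd.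
Proof.
move=> ? ? ?; apply: (@four_triples m ab ac ad bc bd cd (@Ordinal 4 1 isT)).
by case=> -[|[|[|[|//]]]] //= ?; rewrite -val_eqE.
Qed.

Lemma four_triplesC m (ab ac ad bc bd cd : K m.+1) :
  triple ab ac ad -> triple ab bc bd -> triple ad bd cd -> triple ac bc cd.
Proof.
move=> ? ? ?; apply: (@four_triples m ab ac ad bc bd cd (@Ordinal 4 2 isT)).
by case=> -[|[|[|[|//]]]] //= ?; rewrite -val_eqE.
Qed.

Lemma four_triplesD m (ab ac ad bc bd cd : K m.+1) :
  triple ab ac ad -> triple ab bc bd -> triple ac bc cd -> triple ad bd cd.
Proof.
move=> ? ? ?; apply: (@four_triples m ab ac ad bc bd cd (@Ordinal 4 3 isT)).
by case=> -[|[|[|[|//]]]] //= ?; rewrite -val_eqE.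
Qed.

Lemma triple_degen m (x : sphere m) : triple (base K m.+1) x x.
Proof.
exists (degen (inord m.+1) (x : K m.+1)) => i.
rewrite -[i in face i]inord_val; have li := ltn_ord i.
case: ltnP => [im|mi].
  by rewrite face_degen_lt; [rewrite face_sphere degen_base|lia].
case: eqP => [->|im].
  by rewrite face_degen_lt; [rewrite face_sphere degen_base|lia].
by rewrite face_degen_eq; [case: ifP|lia|lia].
Qed.

Lemma triple_degen' m (x : sphere m) : triple x x (base K m.+1).
Proof.
exists (degen (inord m) (x : K m.+1)) => i.
rewrite -[i in face i]inord_val; have li := ltn_ord i.
case: ltnP => [im|mi].
  by rewrite face_degen_lt; [rewrite face_sphere degen_base|lia].
case: eqP => [->|im]; first by rewrite face_degen_eq //; lia.
case: eqP => [->|im']; first by rewrite face_degen_eq //; lia.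
by rewrite face_degen_gt; [rewrite face_sphere degen_base|lia].
Qed.

Lemma sphere_filler m (t : 'I_m.+3 -> sphere m) (k : 'I_m.+3) :
  exists s : sphere m, filled (fun i => if i == k then s : K m.+1 else t i).
Proof.
have tk : horn k (fun i => t i : K m.+1) by move=> i j *; rewrite !face_sphere.
have [w wE] := kanP tk.
have wE' (j : nat) : (j <= m.+2)%N -> j <> k -> face (inord j) w = t (inord j).
  by move=> jm /eqP jk; rewrite wE // -val_eqE /= inordK.
have sph : `[< forall i, face i (face k w) = base K m >].
  apply/asboolP => l; rewrite -[X in face X w]inord_val -[l]inord_val.
  have lm := ltn_ord l; have km := ltn_ord k.
  case: (ltnP l k) => lk.
    by rewrite face_face ?wE' ?face_sphere //; lia.
  by rewrite face2 ?wE' ?face_sphere //; lia.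
exists (exist _ (face k w : {classic K m.+1}) sph), w => i.
by have [->|/wE] := eqVneq i k.
Qed.

Lemma triple_middle m (p r : sphere m) : exists q : sphere m, triple p q r.
Proof.
have [q qP] := sphere_filler (fun i => if i < m then sbase m
  else if i == m :> nat then p else r)%N (inord m.+1).
exists q; apply: filled_ext qP => i; rewrite -val_eqE /= inordK //.
by case: ltnP => im; repeat case: eqP => //; lia.
Qed.

Lemma triple_right m (p q : sphere m) : exists r : sphere m, triple p q r.
Proof.
have [r rP] := sphere_filler (fun i => if i < m then sbase m
  else if i == m :> nat then p else q)%N (inord m.+2).
exists r; apply: filled_ext rP => i; rewrite -val_eqE /= inordK //.
by have li := ltn_ord i; case: ltnP => im; repeat case: eqP => //; lia.
Qed.

Lemma triple_left m (q r : sphere m) : exists p : sphere m, triple p q r.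
Proof.
have [p pP] := sphere_filler (fun i => if i < m then sbase m
  else if i == m.+1 :> nat then q else r)%N (inord m).
exists p; apply: filled_ext pP => i; rewrite -val_eqE /= inordK; last lia.
by have li := ltn_ord i; case: ltnP => im; repeat case: eqP => //; lia.
Qed.

Lemma homotopicE m (x y : sphere m) :
  homotopic (x : K m.+1) y <-> triple (base K m.+1) x y.
Proof.
have E : (fun i : 'I_m.+3 => if (i <= m)%N
      then degen ord_max (face (inord i) (x : K m.+1))
      else if i == m.+1 :> nat then x : K m.+1 else y) =1
   (fun i : 'I_m.+3 => if (i < m)%N then base K m.+1
      else if i == m :> nat then base K m.+1
      else if i == m.+1 :> nat then x : K m.+1 else y).
  by move=> i; rewrite face_sphere degen_base; case: ltngtP.
split=> [[_]|fl]; first exact: filled_ext.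
by split=> [i|]; [rewrite !face_sphere|apply: filled_ext fl => i].
Qed.

Definition hequiv m : rel (sphere m) :=
  fun x y => `[< homotopic (x : K m.+1) y >].

Lemma hequivP m (x y : sphere m) :
  reflect (triple (base K m.+1) x y) (hequiv x y).
Proof. by apply: (iffP (asboolP _)) => /homotopicE. Qed.

Lemma hequiv_equiv m : equiv_class_of (@hequiv m).
Proof.
have b0 := triple_degen (sbase m).
have tr x y z : @hequiv m x y -> hequiv x z -> hequiv y z.
  move=> /hequivP xy /hequivP xz; apply/hequivP.
  exact: four_triplesD b0 xy xz.
have rf x : @hequiv m x x by apply/hequivP/triple_degen.
have sy x y : @hequiv m x y -> hequiv y x by move=> xy; apply: tr xy _.
split=> //; first by move=> x y; apply/idP/idP; apply: sy.
by move=> y x z xy yz; apply: tr yz; apply: sy.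
Qed.

Canonical hequiv_rel m := EquivRelPack (@hequiv_equiv m).
Canonical hequiv_enc m := defaultEncModRel (@hequiv m).

(* pi_n(K, b) for n = m.+1.                                                   *)
Definition homotopy_group m : Type := {eq_quot (@hequiv m)}.
HB.instance Definition _ m := Choice.on (homotopy_group m).
HB.instance Definition _ m := EqQuotient.on (homotopy_group m).

Definition htpy_class m (x : sphere m) : homotopy_group m := \pi x.

Lemma htpy_classP m (x y : sphere m) :
  htpy_class x = htpy_class y <-> triple (base K m.+1) x y.
Proof.
split=> [/eqmodP xy|xy]; first exact/hequivP.
by apply/eqmodP/hequivP.
Qed.

Lemma tripleL m (y y' z x : sphere m) :
  htpy_class y = htpy_class y' -> triple y z x -> triple y' z x.
Proof.
move=> /htpy_classP yy' t.
exact: four_triplesD yy' (triple_degen z) t.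
Qed.

Lemma tripleM m (y z z' x : sphere m) :
  htpy_class z = htpy_class z' -> triple y z x -> triple y z' x.
Proof.
by move=> /esym /htpy_classP zz' t; exact: four_triplesC (triple_degen y) zz' t.
Qed.

Lemma tripleR m (y z x x' : sphere m) :
  htpy_class x = htpy_class x' -> triple y z x -> triple y z x'.
Proof.
move=> /htpy_classP xx' t.
exact: four_triplesC (triple_degen' y) t xx'.
Qed.

Lemma triple_inj m (y z z' x : sphere m) :
  triple y z x -> triple y z' x -> htpy_class z = htpy_class z'.
Proof.
by move=> t t'; apply/htpy_classP; exact: four_triplesB (triple_degen y) t t'.
Qed.

(* Defined on chosen representatives; see mul_htpy_class.                     *)
Definition hmul m (c d : homotopy_group m) : homotopy_group m :=
  htpy_class (sval (cid (triple_middle (repr d) (repr c)))).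

Definition hone m : homotopy_group m := htpy_class (sbase m).

Definition hinv m (c : homotopy_group m) : homotopy_group m :=
  htpy_class (sval (cid (triple_right (repr c) (sbase m)))).

Lemma htpy_class_repr m (c : homotopy_group m) : htpy_class (repr c) = c.
Proof. exact: reprK. Qed.

Lemma hmulE m (x y z : sphere m) :
  triple y z x -> hmul (htpy_class x) (htpy_class y) = htpy_class z.
Proof.
move=> t; rewrite /hmul; case: cid => w /= tw; apply: triple_inj t.
by apply: tripleL (htpy_class_repr _) _; apply: tripleR (htpy_class_repr _) _.
Qed.

Lemma h1mul m : left_id (@hone m) (@hmul m).
Proof.
move=> c; rewrite -(htpy_class_repr c).
exact: (@hmulE _ (sbase m) _ _ (triple_degen' _)).
Qed.

Lemma hmul1 m : right_id (@hone m) (@hmul m).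
Proof.
move=> c; rewrite -(htpy_class_repr c).
exact: (@hmulE _ _ (sbase m) _ (triple_degen _)).
Qed.

Lemma hmulA m : associative (@hmul m).
Proof.
move=> a b c; rewrite -(htpy_class_repr a) -(htpy_class_repr b) -(htpy_class_repr c).
set x := repr a; set y := repr b; set z := repr c.
have [u tu] := triple_middle y x; have [v tv] := triple_middle z y.
have [w tw] := triple_middle z u.
rewrite (hmulE tu) (hmulE tv) (hmulE tw); apply: hmulE.
exact: four_triplesC tv tw tu.
Qed.

Lemma hVmul m : left_inverse (@hone m) (@hinv m) (@hmul m).
Proof.
move=> c; rewrite -{2}(htpy_class_repr c) /hinv; case: cid => w /= tw.
exact: hmulE.
Qed.

Lemma hmulV m : right_inverse (@hone m) (@hinv m) (@hmul m).
Proof.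
move=> c; rewrite -[LHS]h1mul -{1}(hVmul (hinv c)) -hmulA (hmulA (hinv c)).
by rewrite hVmul h1mul hVmul.
Qed.

HB.instance Definition _ m := isGroup.Build (homotopy_group m)
  (@hmulA m) (@h1mul m) (@hmul1 m) (@hVmul m) (@hmulV m).

Lemma mul_htpy_class m (x y z : sphere m) :
  triple y z x -> (htpy_class x * htpy_class y)%g = htpy_class z.
Proof. exact: hmulE. Qed.

End Base.

Section Abelianization.
Variable G : groupType.

(* The commutator subgroup [G, G], the least subgroup with all commutators.   *)
Definition commutator_subgroup : {pred G} :=
  fun x => `[< forall S : groupClosed G,
                 (forall a b : G, [~ a, b]%g \in S) -> x \in S >].

Lemma commutator_mulg_closed : mulg_closed commutator_subgroup.
Proof.
move=> x y /asboolP xS /asboolP yS; apply/asboolP => S hS.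
by rewrite gpredM ?xS ?yS.
Qed.

Lemma commutator_1 : (1 : G)%g \in commutator_subgroup.
Proof. by apply/asboolP => S _; rewrite gpred1. Qed.

Lemma commutator_invg_closed : invg_closed commutator_subgroup.
Proof. by move=> x /asboolP xS; apply/asboolP => S hS; rewrite gpredV xS. Qed.

HB.instance Definition _ :=
  isMulClosed.Build G commutator_subgroup commutator_mulg_closed.
HB.instance Definition _ :=
  isMul1Closed.Build G commutator_subgroup commutator_1.
HB.instance Definition _ :=
  isInvClosed.Build G commutator_subgroup commutator_invg_closed.

Lemma mem_commutator (a b : G) : [~ a, b]%g \in commutator_subgroup.
Proof. by apply/asboolP => S. Qed.

Lemma commutator_conj (x y : G) :
  x \in commutator_subgroup -> (x ^ y)%g \in commutator_subgroup.
Proof.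
move=> xS; have -> : (x ^ y = x * [~ x, y])%g by rewrite /commg mulgA mulgV mul1g.
by rewrite gpredM ?mem_commutator.
Qed.

Definition abel_equiv : rel G := fun x y => (x^-1 * y)%g \in commutator_subgroup.

Lemma abel_equiv_equiv : equiv_class_of abel_equiv.
Proof.
split=> [x|x y|y x z]; rewrite /abel_equiv ?mulVg ?gpred1 //.
  by rewrite -gpredV invgM invgK.
move=> xy yz; have := gpredM _ _ xy yz.
by rewrite -mulgA (mulgA y) mulgV mul1g.
Qed.

Canonical abel_equiv_rel := EquivRelPack abel_equiv_equiv.
Canonical abel_equiv_enc := defaultEncModRel abel_equiv.

Definition abelianization : Type := {eq_quot abel_equiv}.
HB.instance Definition _ := Choice.on abelianization.
HB.instance Definition _ := EqQuotient.on abelianization.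

Definition abel_class (x : G) : abelianization := \pi x.

Lemma abel_classP x y :
  abel_class x = abel_class y <-> (x^-1 * y)%g \in commutator_subgroup.
Proof. by split=> [/eqmodP|?]; last apply/eqmodP. Qed.

Lemma abel_class_repr (c : abelianization) : abel_class (repr c) = c.
Proof. exact: reprK. Qed.

Definition abel_mul (c d : abelianization) := abel_class (repr c * repr d)%g.
Definition abel_inv (c : abelianization) := abel_class (repr c)^-1%g.

Lemma abel_mulE x y :
  abel_mul (abel_class x) (abel_class y) = abel_class (x * y)%g.
Proof.
have /abel_classP xx := abel_class_repr (abel_class x).
have /abel_classP yy := abel_class_repr (abel_class y).
rewrite /abel_mul; move: (repr (abel_class x)) xx => x' xx.
move: (repr (abel_class y)) yy => y' yy.
apply/abel_classP.
have -> : ((x' * y')^-1 * (x * y) = (x'^-1 * x) ^ y' * (y'^-1 * y))%g.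
  by rewrite conjgE invgM !mulgA mulgK.
by rewrite gpredM ?commutator_conj.
Qed.

Lemma abel_invE x : abel_inv (abel_class x) = abel_class x^-1%g.
Proof.
have /abel_classP xx := abel_class_repr (abel_class x).
rewrite /abel_inv; move: (repr (abel_class x)) xx => x' xx; apply/abel_classP.
have -> : ((x'^-1)^-1 * x^-1 = ((x'^-1 * x) ^ x'^-1)^-1)%g.
  by rewrite conjgE invgK !mulgA mulgV mul1g invgM invgK.
by rewrite gpredV commutator_conj.
Qed.

Lemma abel_mulA : associative abel_mul.
Proof.
move=> a b c; rewrite -(abel_class_repr a) -(abel_class_repr b).
by rewrite -(abel_class_repr c) !abel_mulE mulgA.
Qed.

Lemma abel_1mul : left_id (abel_class 1%g) abel_mul.
Proof. by move=> c; rewrite -(abel_class_repr c) abel_mulE mul1g. Qed.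

Lemma abel_mul1 : right_id (abel_class 1%g) abel_mul.
Proof. by move=> c; rewrite -(abel_class_repr c) abel_mulE mulg1. Qed.

Lemma abel_Vmul : left_inverse (abel_class 1%g) abel_inv abel_mul.
Proof.
by move=> c; rewrite -(abel_class_repr c) abel_invE abel_mulE mulVg.
Qed.

Lemma abel_mulV : right_inverse (abel_class 1%g) abel_inv abel_mul.
Proof.
by move=> c; rewrite -(abel_class_repr c) abel_invE abel_mulE mulgV.
Qed.

HB.instance Definition _ := isGroup.Build abelianization
  abel_mulA abel_1mul abel_mul1 abel_Vmul abel_mulV.

Lemma abel_classM x y : abel_class (x * y)%g = (abel_class x * abel_class y)%g.
Proof. by rewrite -[RHS]/(abel_mul _ _) abel_mulE. Qed.

Lemma abelianization_comm (c d : abelianization) : (c * d = d * c)%g.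
Proof.
rewrite -(abel_class_repr c) -(abel_class_repr d) -!abel_classM.
apply/abel_classP.
set x := repr c; set y := repr d.
have -> : ((x * y)^-1 * (y * x) = [~ y, x])%g by rewrite /commg conjgE invgM !mulgA.
exact: mem_commutator.
Qed.

(* The map induced by a homomorphism f; see abel_liftE.                       *)
Definition abel_lift (A : zmodType) (f : G -> A) (c : abelianization) : A :=
  f (repr c).

Lemma abel_liftE (A : zmodType) (f : G -> A) :
  (forall x y, f (x * y)%g = f x + f y) ->
  forall x, abel_lift f (abel_class x) = f x.
Proof.
move=> fM x; rewrite /abel_lift.
have f1 : f 1%g = 0 by apply: (addrI (f 1%g)); rewrite -fM mulg1 addr0.
have fV y : f y^-1%g = - f y.
  by apply: (addrI (f y)); rewrite -fM mulgV f1 addrN.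
pose P : {pred G} := fun x => f x == 0.
have PM : mulg_closed P.
  by move=> a b /eqP fa /eqP fb; rewrite unfold_in fM fa fb addr0.
have P1 : 1%g \in P by rewrite unfold_in f1.
have PV : invg_closed P by move=> a /eqP fa; rewrite unfold_in fV fa oppr0.
pose S : groupClosed G := HB.pack P (isMulClosed.Build G P PM)
  (isMul1Closed.Build G P P1) (isInvClosed.Build G P PV).
have SE y : (y \in S) = (f y == 0) by [].
have /abel_classP/asboolP xS := abel_class_repr (abel_class x).
have : ((repr (abel_class x))^-1 * x)%g \in S.
  apply: xS => a b; rewrite SE /commg conjgE !fM !fV.
  by rewrite [f a + f b]addrC addKr addNr.
by rewrite SE fM fV addrC subr_eq0 => /eqP.
Qed.

End Abelianization.

Record subsset (K : sset) := SubSset {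
  subsimplex :> forall n, K n -> Prop;
  subsset_face : forall n (i : 'I_n.+2) (x : K n.+1), subsimplex x -> subsimplex (face i x);
  subsset_degen : forall n (i : 'I_n.+1) (x : K n), subsimplex x -> subsimplex (degen i x)
}.

Section Homology.
Variables (K : sset) (L : subsset K).

(* The free abelian group Z[K_n].                                             *)
Definition schain n := {freeg {classic K n} / int}.

Definition schain1 n (x : K n) : schain n := << (x : {classic K n}) >>.

Definition sdiff n (c : schain n.+1) : schain n :=
  fglift (fun x : {classic K n.+1} =>
    \sum_(i < n.+2) (-1) ^+ i *: schain1 (face i (x : K n.+1))) c.

(* The subgroup Z[L_n] of Z[K_n]: the chains supported on L_n.                *)
Definition subchain n : {pred schain n} :=
  fun c => `[< forall x : {classic K n}, ~ L n x -> coeff x c = 0 >].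

Lemma subchain_zmod_closed n : zmod_closed (@subchain n).
Proof.
split=> [|c d /asboolP cL /asboolP dL]; apply/asboolP => x xL.
  by rewrite coeff0.
by rewrite coeffB cL // dL // subr0.
Qed.
HB.instance Definition _ n :=
  GRing.isZmodClosed.Build (schain n) (@subchain n) (@subchain_zmod_closed n).

Definition chain n : Type := Quotient.quot (@subchain n).
HB.instance Definition _ n := GRing.Zmodule.on (chain n).
HB.instance Definition _ n := ZmodQuotient.on (chain n).

Definition diff n (c : chain n.+1) : chain n := \pi_(chain n) (sdiff (repr c)).

Lemma subchain1 n (x : K n) : L n x -> schain1 x \in @subchain n.
Proof.
move=> Lx; apply/asboolP => y Ly; rewrite /schain1 coeffU.
by case: eqP => [yx|]; rewrite ?mulr0 //; case: Ly; rewrite -yx.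
Qed.

Lemma sdiff_is_additive n : zmod_morphism (@sdiff n).
Proof. exact: lift_is_additive. Qed.
HB.instance Definition _ n :=
  GRing.isZmodMorphism.Build _ _ (@sdiff n) (@sdiff_is_additive n).

Lemma sdiffU n (z : int) (x : {classic K n.+1}) :
  sdiff << z *g x >> =
  z *: (\sum_(i < n.+2) (-1) ^+ i *: schain1 (face i (x : K n.+1)) : schain n).
Proof. exact: liftU. Qed.

Lemma scale_subchain n (z : int) (c : schain n) :
  c \in @subchain n -> z *: c \in @subchain n.
Proof.
by move=> /asboolP cL; apply/asboolP => x Lx; rewrite coeffZ cL ?mulr0.
Qed.

Lemma sdiff_subchain n (c : schain n.+1) :
  c \in @subchain n.+1 -> sdiff c \in @subchain n.
Proof.
move=> /asboolP cL; rewrite -(freeg_sumE c) raddf_sum rpred_sum // => x _.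
have [Lx|nLx] := pselect (L n.+1 x); last by rewrite cL // freegU0 raddf0 rpred0.
rewrite [X in X \in _]sdiffU scale_subchain // rpred_sum // => i _.
exact/scale_subchain/subchain1/subsset_face.
Qed.

Lemma diff_pi n (c : schain n.+1) : diff (\pi_(chain n.+1) c) = \pi_(chain n) (sdiff c).
Proof.
apply/eqP; rewrite /diff -Quotient.idealrBE -raddfB /= sdiff_subchain //.
by rewrite Quotient.idealrBE reprK.
Qed.

Lemma diff_is_additive n : zmod_morphism (@diff n).
Proof.
move=> c d; rewrite -[c]reprK -[d]reprK.
by rewrite -raddfB !diff_pi raddfB raddfB.
Qed.
HB.instance Definition _ n :=
  GRing.isZmodMorphism.Build _ _ (@diff n) (@diff_is_additive n).

Definition is_cycle n : {pred chain n} :=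
  if n is m.+1 then fun c : chain m.+1 => diff c == 0 else predT.

Lemma is_cycle_zmod_closed n : zmod_closed (@is_cycle n).
Proof.
case: n => [|n]; split=> //; rewrite ?unfold_in /= ?raddf0 //.
by move=> c d; rewrite !unfold_in /= => /eqP dc /eqP dd; rewrite raddfB /= dc dd subr0.
Qed.
HB.instance Definition _ n :=
  GRing.isZmodClosed.Build (chain n) (@is_cycle n) (@is_cycle_zmod_closed n).

Definition cycles n : Type := {c : chain n | c \in @is_cycle n}.
HB.instance Definition _ n := SubChoice.on (cycles n).
HB.instance Definition _ n := [SubChoice_isSubZmodule of (cycles n) by <:].

Definition is_boundary n : {pred cycles n} :=
  fun c => `[< exists b : chain n.+1, diff b = val c >].

Lemma is_boundary_zmod_closed n : zmod_closed (@is_boundary n).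
Proof.
split=> [|c d /asboolP[a ac] /asboolP[b bd]]; apply/asboolP.
  by exists 0; rewrite raddf0.
by exists (a - b); rewrite raddfB /= ac bd.
Qed.
HB.instance Definition _ n :=
  GRing.isZmodClosed.Build (cycles n) (@is_boundary n) (@is_boundary_zmod_closed n).

Definition homology n : Type := Quotient.quot (@is_boundary n).
HB.instance Definition _ n := GRing.Zmodule.on (homology n).
HB.instance Definition _ n := ZmodQuotient.on (homology n).

Definition homology_class n (c : cycles n) : homology n := \pi_(homology n) c.

Lemma homology_class_is_additive n : zmod_morphism (@homology_class n).
Proof. by move=> c d; rewrite /homology_class raddfB. Qed.
HB.instance Definition _ n :=
  GRing.isZmodMorphism.Build _ _ (@homology_class n) (@homology_class_is_additive n).

Lemma homology_class_eq0 n (c : cycles n) :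
  homology_class c = 0 <-> exists b, diff b = val c.
Proof.
rewrite -(raddf0 (@homology_class n)) /homology_class (rwP eqP).
by rewrite -Quotient.idealrBE subr0; split=> /asboolP.
Qed.

Definition chain1 n (x : K n) : chain n := \pi_(chain n) (schain1 x).

Lemma chain1_sub n (x : K n) : L n x -> chain1 x = 0.
Proof.
move=> Lx; rewrite -[0](raddf0 (\pi_(chain n))) /chain1.
by apply/eqP; rewrite -Quotient.idealrBE subr0 subchain1.
Qed.

Lemma diff1 n (x : K n.+1) :
  diff (chain1 x) = \sum_(i < n.+2) chain1 (face i x) *~ (-1) ^+ i.
Proof.
rewrite /chain1 diff_pi -[schain1 x]/(<< 1 *g (x : {classic K n.+1}) >>) sdiffU.
rewrite scale1r raddf_sum; apply: eq_bigr => i _.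
by rewrite -[X in X *: _]intz scaler_int raddfMz.
Qed.

End Homology.

Definition group_iso (G : groupType) (A : zmodType) (f : G -> A) : Prop :=
  (forall x y : G, f (x * y)%g = f x + f y) /\ bijective f.

Section Hurewicz.
Variable K : ptd_kan.

Lemma base_subset_face n (i : 'I_n.+2) (x : K n.+1) :
  x = base K n.+1 -> face i x = base K n.
Proof. by move=> ->; apply: face_base. Qed.

Lemma base_subset_degen n (i : 'I_n.+1) (x : K n) :
  x = base K n -> degen i x = base K n.+1.
Proof. by move=> ->; apply: degen_base. Qed.

Definition base_subsset : subsset K :=
  @SubSset K (fun n x => x = base K n) base_subset_face base_subset_degen.

Local Notation L := base_subsset.

Lemma chain1_base n : chain1 L (base K n) = 0.
Proof. exact: chain1_sub. Qed.

Lemma sphere_is_cycle m (x : sphere K m) :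
  chain1 L (x : K m.+1) \in @is_cycle K L m.+1.
Proof.
rewrite unfold_in /= diff1 big1 // => i _.
by rewrite face_sphere chain1_base mul0rz.
Qed.

Definition sphere_cycle m (x : sphere K m) : cycles L m.+1 :=
  exist _ (chain1 L (x : K m.+1)) (sphere_is_cycle x).

(* [x]_H for x of dimension m.+1 with boundary at the base point.             *)
Definition sphere_homology_class m (x : sphere K m) : homology L m.+1 :=
  homology_class (sphere_cycle x).

Lemma triple_homology m (p q r : sphere K m) :
  triple (p : K m.+1) q r ->
  sphere_homology_class p - sphere_homology_class q + sphere_homology_class r = 0.
Proof.
case=> w wE; rewrite -raddfB -raddfD /=; apply/homology_class_eq0.
exists (chain1 L w *~ (-1) ^+ m); rewrite raddfMz /= diff1 3!big_ord_recr /=.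
rewrite !wE /= big1 ?add0r => [|i _]; last first.
  by rewrite wE /= ltn_ord chain1_base mul0rz.
rewrite ltnn eqxx !(ltnNge _ m) !leqnSn /= (gtn_eqF (ltnSn m)) eqxx.
rewrite leqW //= !ifF ?eqn_leq; try lia.
rewrite !exprS -(signr_odd _ m); case: (odd m); rewrite ?expr0 ?expr1.
  rewrite !mulN1r !opprK !mulrN1z !mulr1z !opprD !opprK.
  by [].
by rewrite !mulr1 !mulN1r !opprK !mulrN1z !mulr1z.
Qed.

Lemma sphere_homology_class_base m : sphere_homology_class (sbase K m) = 0.
Proof.
have := @triple_homology m (sbase K m) _ _ (triple_degen (sbase K m)).
by rewrite subrr add0r.
Qed.

(* Defined on a chosen representative; see hurewiczE and hurewiczM.           *)
Definition hurewicz m (c : homotopy_group K m) : homology L m.+1 :=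
  sphere_homology_class (repr c).

Lemma hurewiczE m (x : sphere K m) :
  hurewicz (htpy_class x) = sphere_homology_class x.
Proof.
have /htpy_classP t := htpy_class_repr (htpy_class x).
have := @triple_homology _ (sbase K m) _ _ t.
by rewrite sphere_homology_class_base sub0r addrC => /subr0_eq.
Qed.

Lemma hurewiczM m (c d : homotopy_group K m) :
  hurewicz (c * d)%g = hurewicz c + hurewicz d.
Proof.
rewrite -(htpy_class_repr c) -(htpy_class_repr d).
have [z t] := triple_middle (repr d) (repr c).
rewrite (mul_htpy_class t) !hurewiczE; have := triple_homology t.
by rewrite addrAC => /subr0_eq <-; rewrite addrC.
Qed.

End Hurewicz.

(* Main.v *)
From HB Require Import structures.
Require Import Defs.
From mathcomp Require Import all_boot all_order all_algebra.
From mathcomp Require Import generic_quotient ring_quotient.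
From mathcomp Require Import boolp freeg zify.

(** Write n = m + 1. As K has a single simplex in dimension n - 1, every n-simplex
    is a sphere and every n-chain is a cycle. The class of a chain is therefore a
    combination of classes of spheres, and since the Hurewicz map is a
    homomorphism it is onto ([hurewicz_surj]).

    For injectivity, let kappa be a homomorphism from the homotopy group to an
    abelian group A. Sending a simplex x to kappa [x] extends to a homomorphism
    from n-chains to A ([chain_eval]). If it kills boundaries, then homologous
    spheres have the same image under kappa ([homology_class_eval_inj]). Taking
    for kappa the abelianization map, or the identity once the homotopy group is
    known to be abelian, gives the theorem.

    To kill boundaries means that kappa has alternating sum 0 on the faces of any
    (n+1)-simplex ([altsum_face]), that is, on any filled (n+2)-tuple of spheres.
    The product of the homotopy group is defined by tuples whose first n - 1
    entries are the base point, so the matter is to relate other filled tuples to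
    those. All relations come from [filled_matrix]: in a symmetric array of
    spheres, if all rows but one are filled, so is the last. A suitable array
    merges the first nontrivial entry of a filled tuple into its neighbour without
    changing the alternating sum ([filled_at_merge]), which reduces the claim to
    triples of consecutive entries p, q, r. Another array moves such a triple one
    position to the right ([filled_at_shift]), so that r p = q in the homotopy
    group wherever the triple sits ([mul_filled_at]).

    If n >= 2, there is room for a second way to move a triple
    ([filled_at_rotate]), which reverses the order of the factors. Comparing both
    moves shows that the homotopy group is abelian ([homotopy_group_comm]). *)

Set Implicit Arguments.
Unset Strict Implicit.
Unset Printing Implicit Defensive.

Import GRing.Theory.
Local Open Scope ring_scope.
Local Open Scope quotient_scope.

(** * Filled tuples supported on the last positions *)

Section Tuples.
Variables (K : ptd_kan) (m : nat).
Local Notation b := (sbase K m).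

Definition filled_from k (g : nat -> sphere K m) : Prop :=
  filled (fun i : 'I_m.+3 => if (i < k)%N then base K m.+1 else g (i - k)%N : K m.+1).

Lemma eq_filled_from k g h : g =1 h -> filled_from k g -> filled_from k h.
Proof. by move=> gh; apply: filled_ext => i; rewrite gh. Qed.

Definition row (f : nat -> nat -> sphere K m) j l :=
  if (l < j)%N then f l j else f j l.+1.

(** Here [f i j] is the entry at the letters k + i and k + j of the array in
    [filled_matrix]; letters below k contribute only entries at the base point,
    so their rows are filled for free. *)
Lemma filled_from_matrix k (f : nat -> nat -> sphere K m) j0 :
    (k + j0 <= m.+3)%N ->
    (forall j, j != j0 -> (k + j <= m.+3)%N -> filled_from k (row f j)) ->
  filled_from k (row f j0).
Proof.
move=> kj0 rows.
pose a i j : K m.+1 := if (i < k)%N then base K m.+1 else f (i - k)%N (j - k)%N.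
pose arow j := fun l : 'I_m.+3 => if (l < j)%N then a l j else a j l.+1.
have arowE j : (k <= j)%N -> arow j =1
    (fun i : 'I_m.+3 => if (i < k)%N then base K m.+1
                        else row f (j - k)%N (i - k)%N : K m.+1).
  move=> kj l; rewrite /arow /a /row; have [lk|kl] := ltnP l k.
    by rewrite (leq_trans lk kj).
  rewrite subSn // ltn_sub2rE // (ltnNge j) kj /=.
  by case: ltnP.
have kj0' : (k + j0 < m.+4)%N by lia.
rewrite /filled_from -(addKn k j0).
apply: (filled_ext (arowE _ (leq_addr _ _))).
apply: (@filled_matrix _ _ a (Ordinal kj0')) => j; rewrite -val_eqE /= => jj0.
have lj := ltn_ord j.
have [jk|kj] := ltnP j k.
  exists (base K m.+2) => l; rewrite face_base /a jk.
  by case: ltnP => // lj'; rewrite (ltn_trans lj' jk).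
apply: (filled_ext (fsym (arowE _ kj))); apply: rows; lia.
Qed.

(** Since [nth] pads with the base point, trailing base points of [s] need not
    be written, and [filled_at k [:: p; q; r]] is a copy of [triple p q r] moved
    to the positions k, k+1, k+2. *)
Definition filled_at k (s : seq (sphere K m)) := filled_from k (nth b s).

Lemma filled_at_cons_base k s : filled_at k (b :: s) <-> filled_at k.+1 s.
Proof.
have E : (fun i : 'I_m.+3 => if (i < k)%N then base K m.+1
                             else nth b (b :: s) (i - k) : K m.+1) =1
         (fun i : 'I_m.+3 => if (i < k.+1)%N then base K m.+1
                             else nth b s (i - k.+1) : K m.+1).
  move=> i; rewrite ltnS; case: (ltngtP i k) => [//|ki|->]; last by rewrite subnn.
  by rewrite -[(i - k)%N]prednK ?subn_gt0 // -subnS.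
split; [exact: (filled_ext E)|exact: (filled_ext (fsym E))].
Qed.

Lemma filled_at_triple p q r : filled_at m [:: p; q; r] <-> triple (p : K m.+1) q r.
Proof.
have E : (fun i : 'I_m.+3 => if (i < m)%N then base K m.+1
                             else nth b [:: p; q; r] (i - m) : K m.+1) =1
         (fun i : 'I_m.+3 =>
    if (i < m)%N then base K m.+1
    else if i == m :> nat then p : K m.+1
    else if i == m.+1 :> nat then q : K m.+1 else r).
  move=> i; have li := ltn_ord i; case: ltngtP => [//|ki|->]; last by rewrite subnn.
  case: eqP => [->|ni]; first by rewrite subSnn.
  by have -> : (i - m = 2)%N by lia.
split; [exact: (filled_ext E)|exact: (filled_ext (fsym E))].
Qed.

Lemma filled_at_dup k x : (k <= m.+1)%N -> filled_at k [:: x; x].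
Proof.
move=> km; exists (degen (inord k) (x : K m.+1)) => i.
rewrite -[i in face i]inord_val; have li := ltn_ord i.
case: (ltngtP i k) => [ik|ki|->].
- by rewrite face_degen_lt; [rewrite face_sphere degen_base|lia].
- have [->|nik] := eqVneq (i : nat) k.+1.
    by rewrite subSnn face_degen_eq //; lia.
  rewrite face_degen_gt; last by lia.
  rewrite face_sphere degen_base.
  by have [j ->] : exists j, (i - k = j.+2)%N; [exists (i - k).-2; lia|case: j].
- by rewrite subnn face_degen_eq; lia || by [].
Qed.

Lemma filled_at_dup_pad k j x : (k + j <= m.+1)%N ->
  filled_at k (ncons j b [:: x; x]).
Proof.
elim: j k => [|j IHj] k kj; first by apply: filled_at_dup; lia.
by apply/filled_at_cons_base/IHj; lia.
Qed.

Lemma filled_at_set_nth k s j : (k + j <= m.+2)%N ->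
  exists x, filled_at k (set_nth b s j x).
Proof.
move=> kj; have [x xP] := sphere_filler (fun i : 'I_m.+3 => if (i < k)%N then b
  else nth b s (i - k)%N) (inord (k + j)).
exists x; apply: filled_ext xP => i; rewrite -val_eqE /= inordK // nth_set_nth /=.
case: (ltnP i k) => ki.
  by rewrite ltn_eqF //; lia.
have -> : ((i : nat) == k + j)%N = ((i - k)%N == j) by apply/eqP/eqP; lia.
by case: ifP.
Qed.

Lemma filled_at_nil k : filled_at k [::].
Proof. by exists (base K m.+2) => i; rewrite face_base; case: ifP; rewrite ?nth_nil. Qed.

(** The first entry of a filled tuple can be merged into the second one, the
    triple at [k] computing the merged entry: the alternating sum is preserved
    and the support shrinks. In the matrix, rows 2 and 3 agree from position 2 on;
    as these rows are adjacent, every later row has two equal neighbours and the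
    base point elsewhere, so that a degenerate simplex fills it. *)
Lemma filled_at_merge k p q r s q' : (k <= m)%N ->
  filled_at k [:: p, q, r & s] -> filled_at k [:: p; q; q'] ->
  filled_at k.+1 [:: q', r & s].
Proof.
move=> km ft fl; apply/filled_at_cons_base.
pose f i j := match i, j with
  | 0, 1 => p | 0, 2 => p | 1, 2 => q | 1, 3 => q'
  | 2, j => nth b (r :: s) (j - 3) | 3, j => nth b (r :: s) (j - 3)
  | _, _ => b end%N.
have rowE : row f 3 =1 nth b [:: b, q', r & s].
  by case=> [|[|[|l]]] //=; rewrite /row /= !subSS ?subn0.
apply: eq_filled_from rowE _.
apply: filled_from_matrix => [|[|[|[|[|j]]]] // _ kj]; first by lia.
- have := @filled_at_dup_pad k 0 p ltac:(lia).
  by apply: eq_filled_from; case=> [|[|l]] //=; rewrite nth_nil.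
- by apply: eq_filled_from fl; case=> [|[|[|l]]] //=; rewrite nth_nil.
- by apply: eq_filled_from ft; case=> [|[|l]] //=; rewrite /row /= !subSS ?subn0.
have := @filled_at_dup_pad k 2 (nth b s j) ltac:(lia).
apply: eq_filled_from; case=> [|[|[|[|l]]]] //=; rewrite /row /= ?nth_nil //.
by case: ifP.
Qed.

(** With p and q inverse to each other at [k], a triple starting with q at [k]
    yields a tuple at the same position which merging p with the base point
    would turn into the same triple, but at [k.+1]. This is what lets a triple
    change position. Five letters are needed, whence the condition on [k]. *)
Lemma filled_at_unmerge k p b' q x : (k < m)%N ->
  filled_at k [:: p; b; q] -> filled_at k [:: q; b'; x] ->
  filled_at k [:: p; b; b'; x].
Proof.
move=> km fp fq.
pose f i j := match i, j with
  | 0, 1 => p | 0, 3 => q | 1, 3 => b' | 1, 4 => x | 2, 3 => x | 2, 4 => x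
  | _, _ => b end%N.
have rowE : row f 1 =1 nth b [:: p; b; b'; x].
  by case=> [|[|[|[|l]]]] //=; rewrite nth_nil.
apply: eq_filled_from rowE _.
apply: filled_from_matrix => [|[|[|[|[|[|j]]]]] // _ kj]; first by lia.
- by apply: eq_filled_from fp; case=> [|[|[|l]]] //=; rewrite nth_nil.
- have := @filled_at_dup_pad k 2 x ltac:(lia).
  by apply: eq_filled_from; case=> [|[|[|[|l]]]] //=; rewrite nth_nil.
- by apply: eq_filled_from fq; case=> [|[|[|[|l]]]] //=; rewrite nth_nil.
- have := @filled_at_dup_pad k 1 x ltac:(lia).
  by apply: eq_filled_from; case=> [|[|[|[|l]]]] //=; rewrite nth_nil.
apply: eq_filled_from (filled_at_nil k); case=> [|[|[|l]]]; rewrite nth_nil //=.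
by rewrite /row; case: ifP.
Qed.

(** Unmerge with an inverse y of p, then merge y with the base point. Hence the
    group laws read off at different positions agree. *)
Lemma filled_at_shift k p q r : (k < m)%N ->
  filled_at k [:: p; q; r] -> filled_at k.+1 [:: p; q; r].
Proof.
move=> km fpqr.
have [|y fy] := @filled_at_set_nth k [:: b; b; p] 0; first by lia.
exact: filled_at_merge (ltnW km) (filled_at_unmerge km fy fpqr) fy.
Qed.

(** A second way of moving a triple, with another order of the factors: with r'
    inverse to r, the relation r p = q becomes q r' = p. As [filled_at_shift]
    makes both relations hold in one group, they force r p = p r. *)
Lemma filled_at_rotate k p q r r' : (k < m)%N ->
  filled_at k [:: p; q; r] -> filled_at k [:: r'; b; r] ->
  filled_at k.+1 [:: r'; p; q].
Proof.
move=> km fp fr.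
pose f i j := match i, j with
  | 0, 2 => r' | 0, 3 => p | 0, 4 => q | 1, 3 => q | 1, 4 => q | 2, 3 => r
  | _, _ => b end%N.
apply/filled_at_cons_base.
have rowE : row f 0 =1 nth b [:: b; r'; p; q].
  by case=> [|[|[|[|l]]]] //=; rewrite nth_nil.
apply: eq_filled_from rowE _.
apply: filled_from_matrix => [|[|[|[|[|[|j]]]]] // _ kj]; first by lia.
- have := @filled_at_dup_pad k 2 q ltac:(lia).
  by apply: eq_filled_from; case=> [|[|[|[|l]]]] //=; rewrite nth_nil.
- by apply: eq_filled_from fr; case=> [|[|[|l]]] //=; rewrite nth_nil.
- by apply: eq_filled_from fp; case=> [|[|[|[|l]]]] //=; rewrite nth_nil.
- have := @filled_at_dup_pad k 0 q ltac:(lia).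
  by apply: eq_filled_from; case=> [|[|[|[|l]]]] //=; rewrite nth_nil.
apply: eq_filled_from (filled_at_nil k); case=> [|[|[|l]]]; rewrite nth_nil //=.
by rewrite /row; case: ifP.
Qed.

(** * The group law at each position and commutativity *)

Lemma mul_filled_at k p q r : (k <= m)%N -> filled_at k [:: p; q; r] ->
  (htpy_class r * htpy_class p)%g = htpy_class q.
Proof.
move=> km; rewrite -(subKn km); move: (m - k)%N (leq_subr k m) => j.
elim: j => [|j IHj] jm fpqr.
  by apply/mul_htpy_class/filled_at_triple; rewrite subn0 in fpqr.
apply: IHj; first exact: ltnW.
have -> : (m - j = (m - j.+1).+1)%N by lia.
by apply: filled_at_shift fpqr; lia.
Qed.

Lemma homotopy_group_comm (c d : homotopy_group K m) : (0 < m)%N ->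
  (c * d = d * c)%g.
Proof.
move=> m0; rewrite -(htpy_class_repr c) -(htpy_class_repr d).
set r := repr c; set p := repr d.
have km : (m.-1 < m)%N by lia.
have [|q fq] := @filled_at_set_nth m.-1 [:: p; b; r] 1; first by lia.
have [|r' fr] := @filled_at_set_nth m.-1 [:: b; b; r] 0; first by lia.
have rp := mul_filled_at (ltnW km) fq; have rr' := mul_filled_at (ltnW km) fr.
have pq := mul_filled_at km (filled_at_rotate km fq fr); rewrite -[in RHS]pq.
have -> : htpy_class r' = (htpy_class r)^-1%g by apply/esym/mulg1_eq.
by rewrite -mulgA mulVg mulg1 rp.
Qed.

(** * The alternating sum of a filled tuple *)

(** From here on the classes of spheres are evaluated in an abelian group: on the
    homotopy group itself in dimension at least 2, on its abelianization in
    dimension 1. *)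
Section AlternatingSum.
Variables (A : zmodType) (kappa : homotopy_group K m -> A).
Hypothesis kappaM : forall c d, kappa (c * d)%g = kappa c + kappa d.

Definition altsum := foldr (fun x a => kappa (htpy_class x) - a) 0.

Lemma altsumE s :
  altsum s = \sum_(0 <= i < size s) kappa (htpy_class (nth b s i)) *~ (-1) ^+ i.
Proof.
elim: s => [|x s IHs] /=; first by rewrite big_nil.
rewrite big_nat_recl //= expr0 mulr1z IHs -sumrN; congr (_ + _).
by apply: eq_bigr => i _; rewrite exprS mulN1r mulrNz.
Qed.

(** Merging entries from the left leaves a filled tuple supported on the last
    three positions, where the claim is the definition of the product. *)
Lemma altsum_filled_at k s : (k <= m)%N -> (k + size s = m.+3)%N ->
  filled_at k s -> altsum s = 0.
Proof.
move=> km; rewrite -(subKn km); move: (m - k)%N (leq_subr k m) => j.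
elim: j s => [|j IHj] [|p [|q [|r s]]] /= jm ss; try lia.
  case: s ss => [|? ?] /=; last by lia.
  move=> _; rewrite subn0 => /mul_filled_at <- //.
  by rewrite kappaM subr0 addrAC subrr add0r subrr.
move=> ft; have km' : (m - j.+1 < m)%N by lia.
have [|q' fq] := @filled_at_set_nth (m - j.+1) [:: p; q; b] 2; first by lia.
have kq := mul_filled_at (ltnW km') fq; rewrite -kq kappaM.
rewrite [kappa (htpy_class q') + _]addrC -addrA opprD addrA subrr add0r.
apply/eqP; rewrite oppr_eq0; apply/eqP.
apply: (IHj [:: q', r & s]) => //=; try lia.
have -> : (m - j = (m - j.+1).+1)%N by lia.
exact: filled_at_merge (ltnW km') ft fq.
Qed.

Lemma altsum_face (w : K m.+2) (t : 'I_m.+3 -> sphere K m) :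
    (forall i, face i w = t i) ->
  \sum_(i < m.+3) kappa (htpy_class (t i)) *~ (-1) ^+ i = 0.
Proof.
move=> tE; pose s := codom t.
have ss : size s = m.+3 by rewrite size_codom card_ord.
have st (i : 'I_m.+3) : nth b s i = t i.
  by rewrite /s codomE (nth_map ord0) ?size_enum_ord ?nth_ord_enum.
have fs : filled_at 0 s by exists w => i; rewrite tE /= subn0 st.
rewrite -[RHS](altsum_filled_at (leq0n m) ss fs).
by rewrite altsumE ss big_mkord; apply: eq_bigr => i _; rewrite st.
Qed.
End AlternatingSum.
End Tuples.

(** * Injectivity: evaluating chains in an abelian group *)

Section Injectivity.
Variables (K : ptd_kan) (m : nat).
Hypothesis K_trivial : forall x : K m, x = base K m.
Local Notation L := (base_subsset K).

Lemma simplex_sphere (x : K m.+1) : `[< forall i, face i x = base K m >].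
Proof. by apply/asboolP => i; apply: K_trivial. Qed.

Definition sphere_of (x : K m.+1) : sphere K m :=
  exist _ (x : {classic K m.+1}) (simplex_sphere x).

Lemma sphere_ofK (x : sphere K m) : sphere_of x = x.
Proof. exact: val_inj. Qed.

Section Evaluation.
Variables (A : zmodType) (kappa : homotopy_group K m -> A).
Hypothesis kappaM : forall c d, kappa (c * d)%g = kappa c + kappa d.

Let kappa1 : kappa 1%g = 0.
Proof. by apply: (addrI (kappa 1%g)); rewrite -kappaM mulg1 addr0. Qed.

(** [zmodule A] is [A] with the module structure over the integers that [fglift]
    needs. *)
Definition chain_eval (c : schain K m.+1) : zmodule A :=
  fglift (fun x : {classic K m.+1} =>
    kappa (htpy_class (sphere_of x)) : zmodule A) c.

Lemma chain_eval_is_additive : zmod_morphism chain_eval.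
Proof. exact: lift_is_additive. Qed.
HB.instance Definition _ :=
  GRing.isZmodMorphism.Build _ _ chain_eval chain_eval_is_additive.

Lemma chain_evalU (z : int) (x : {classic K m.+1}) :
  chain_eval << z *g x >> = kappa (htpy_class (sphere_of x)) *~ z.
Proof. exact: liftU. Qed.

Lemma chain_eval1 (x : sphere K m) :
  chain_eval (schain1 (x : K m.+1)) = kappa (htpy_class x).
Proof. by rewrite /schain1 chain_evalU sphere_ofK. Qed.

Lemma chain_eval_subchain c : c \in @subchain K L m.+1 -> chain_eval c = 0.
Proof.
move=> /asboolP cL; rewrite -(freeg_sumE c) raddf_sum big1 // => x _.
rewrite [LHS]chain_evalU; have [xb|xb] := pselect (x = base K m.+1).
  have -> : sphere_of x = sbase K m by apply: val_inj.
  by rewrite [kappa _]kappa1 mul0rz.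
by rewrite cL.
Qed.

(** The faces of a simplex form a filled tuple of spheres. *)
Lemma chain_eval_sdiff (c : schain K m.+2) : chain_eval (sdiff c) = 0.
Proof.
have simplex0 (w : K m.+2) : chain_eval (sdiff (schain1 w)) = 0.
  rewrite [sdiff _]sdiffU scale1r raddf_sum.
  rewrite -[RHS](@altsum_face K m A kappa kappaM w
    (fun i => sphere_of (face i w))) //.
  apply: eq_bigr => i _; rewrite -[X in X *: _]intz scaler_int [LHS]raddfMz.
  by rewrite -chain_eval1.
rewrite -(freeg_sumE c) raddf_sum raddf_sum big1 // => w _.
by rewrite -[coeff w c]intz -freegU_mulz /= !raddfMz [X in X *~ _]simplex0 mul0rz.
Qed.

(** [chain_eval] kills boundaries and chains on the base point, so it descends to
    homology, where its composite with the Hurewicz map is [kappa]. *)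
Lemma homology_class_eval_inj (x y : sphere K m) :
  sphere_homology_class x = sphere_homology_class y ->
  kappa (htpy_class x) = kappa (htpy_class y).
Proof.
move=> /eqP; rewrite -subr_eq0 -raddfB => /eqP/homology_class_eq0[d dE].
rewrite -[d]reprK diff_pi /= -raddfB /= in dE.
move/eqP: dE; rewrite -Quotient.idealrBE => /chain_eval_subchain/eqP.
rewrite raddfB /= chain_eval_sdiff raddfB /= !chain_eval1.
by rewrite sub0r oppr_eq0 subr_eq0 => /eqP.
Qed.
End Evaluation.
End Injectivity.

(** * Surjectivity: every class is spherical *)

Section Image.
Variables (K : ptd_kan) (m : nat).
Local Notation L := (base_subsset K).

Definition hurewicz_image : {pred homology L m.+1} :=
  fun h => `[< exists c, hurewicz c = h >].

Lemma hurewicz_image_zmod_closed : zmod_closed hurewicz_image.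
Proof.
have phi1 : hurewicz (1 : homotopy_group K m)%g = 0.
  by rewrite [LHS]hurewiczE sphere_homology_class_base.
split=> [|_ _ /asboolP[c <-] /asboolP[d <-]]; apply/asboolP; first by exists 1%g.
exists (c * d^-1)%g; rewrite hurewiczM; congr (_ + _).
by apply: (addrI (hurewicz d)); rewrite -hurewiczM mulgV phi1 subrr.
Qed.
HB.instance Definition _ :=
  GRing.isZmodClosed.Build _ hurewicz_image hurewicz_image_zmod_closed.

Hypothesis K_trivial : forall x : K m, x = base K m.

(** A generator is a sphere, hence a cycle whose class is in the image; the
    image being a subgroup, the same holds for all chains. *)
Lemma chain_homology_image (c : schain K m.+1) : exists2 z : cycles L m.+1,
  val z = \pi_(chain L m.+1) c & homology_class z \in hurewicz_image.
Proof.
rewrite -(freeg_sumE c); elim/big_ind: _ => [|c1 c2 [z1 e1 h1] [z2 e2 h2]|x _].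
- by exists 0; rewrite ?raddf0 ?rpred0.
- exists (z1 + z2); last by rewrite raddfD rpredD.
  by rewrite !raddfD /= e1 e2.
exists (sphere_cycle (sphere_of K_trivial x) *~ coeff x c).
  by rewrite -[coeff x c in RHS]intz -freegU_mulz !raddfMz.
rewrite raddfMz rpredMz //; apply/asboolP.
by exists (htpy_class (sphere_of K_trivial x)); rewrite hurewiczE.
Qed.

Lemma hurewicz_surj (h : homology L m.+1) : exists c, hurewicz c = h.
Proof.
have [z zE hz] := chain_homology_image (repr (val (repr h))).
apply/asboolP; move: hz; rewrite reprK in zE.
by rewrite /homology_class (val_inj zE) reprK.
Qed.
End Image.

(** * The isomorphism *)

Section CommutativeGroup.
Variables (G : groupType) (mulC : forall x y : G, (x * y = y * x)%g).

(** A copy of [G] in additive notation. The proof of commutativity is part of the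
    type, so that the canonical zmodType structure can depend on it. *)
Definition additive_group : Type := let _ := mulC in G.
HB.instance Definition _ := Choice.on additive_group.

Let add (x y : additive_group) : additive_group := ((x : G) * (y : G))%g.
Let opp (x : additive_group) : additive_group := (x : G)^-1%g.

Lemma additive_groupA : associative add. Proof. exact: mulgA. Qed.
Lemma additive_groupC : commutative add. Proof. exact: mulC. Qed.
Lemma additive_group0 : left_id (1%g : G) add. Proof. exact: mul1g. Qed.
Lemma additive_groupN : left_inverse (1%g : G) opp add. Proof. exact: mulVg. Qed.
HB.instance Definition _ := GRing.isZmodule.Build additive_group
  additive_groupA additive_groupC additive_group0 additive_groupN.

End CommutativeGroup.

(** The Hurewicz map identifies no more than any homomorphism to an abelian group
    does; such an [f] is the identity if the homotopy group is abelian, and the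
    abelianization map in general. *)
Lemma hurewicz_inj (K : ptd_kan) (m : nat) (G : groupType)
    (f : homotopy_group K m -> G) (c d : homotopy_group K m) :
  (forall x : K m, x = base K m) ->
  (forall x y : G, (x * y = y * x)%g) ->
  (forall c d, f (c * d)%g = (f c * f d)%g) ->
  hurewicz c = hurewicz d -> f c = f d.
Proof.
move=> K_trivial mulC fM; rewrite -(htpy_class_repr c) -(htpy_class_repr d) !hurewiczE.
exact: (@homology_class_eval_inj K m K_trivial (additive_group mulC) f fM).
Qed.

Lemma inj_surj_bij (S T : Type) (f : S -> T) :
  injective f -> (forall y, exists x, f x = y) -> bijective f.
Proof.
move=> finj /choice[g fgK]; exists g => // x; exact: finj.
Qed.

Theorem mainTheorem4 (K : ptd_kan) (m : nat)
    (K_trivial : forall x : K m, x = base K m) :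
  (* n = m.+1, so the hypothesis is on K_(n-1), and n >= 1 *)
  let phi : homotopy_group K m -> homology (base_subsset K) m.+1 :=
    @hurewicz K m in
  let phi_ab : abelianization (homotopy_group K m) ->
      homology (base_subsset K) m.+1 := abel_lift phi in
  [/\ forall x : sphere K m, phi (htpy_class x) = sphere_homology_class x,
      (2 <= m.+1)%N -> group_iso phi
    & m.+1 = 1%N ->
      (forall c : homotopy_group K m, phi_ab (abel_class c) = phi c) /\
      group_iso phi_ab].
Proof.
move=> phi phi_ab.
have phi_abE c : phi_ab (abel_class c) = phi c by apply/abel_liftE/hurewiczM.
split=> [x|m0|_]; first exact: hurewiczE.
  split; first exact: hurewiczM.
  apply: inj_surj_bij (hurewicz_surj K_trivial) => c d.
  by apply: (@hurewicz_inj K m _ id) => // x y; apply: homotopy_group_comm.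
split=> //; split=> [c d|].
  rewrite -(abel_class_repr c) -(abel_class_repr d) -abel_classM !phi_abE.
  exact: hurewiczM.
apply: inj_surj_bij => [c d|h]; last first.
  by have [c <-] := hurewicz_surj K_trivial h; exists (abel_class c).
rewrite -(abel_class_repr c) -(abel_class_repr d) !phi_abE.
apply: hurewicz_inj => //; [exact: abelianization_comm|exact: abel_classM].
Qed.
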